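(* Let $\mathscr{X}=(P,\Theta_P)$ be a div point set with $|P|=5$ satisfying the laws (L1), (L2), (L3) below. Then, among the five sub div point sets $\mathscr{X}|_R$ with $R\subseteq P$, $|R|=4$, the number that are isomorphic to $Conc_4^1$ is $4$, $2$ or $0$, and each of the remaining ones is isomorphic to $Conv_4$.
   Context: A div point set is an ordered pair $(P,\Theta_P)$ where $P$ is a nonempty finite set and $\Theta_P$ is a set with $|\Theta_P|=\binom{|P|}{2}$ such that every $D\in\Theta_P$ is an ordered pair $D=(d,\delta)$ with $d\subseteq P$, $|d|=2$, and $\delta$ a set with exactly two elements (subsets of $P$) with $\bigcup\delta=P\setminus d$ and $\bigcap\delta=\varnothing$; and two elements of $\Theta_P$ are equal iff their first components are equal. Write $\pi_1(D)=d$, $\pi_2(D)=\delta$. For a set $\delta$ of sets and a 2-element set $T\subseteq\bigcup\delta$, $\phi(\delta,T)=1$ if some element of $\delta$ contains $T$, and $\phi(\delta,T)=0$ otherwise (each element of $\delta$ meets $T$ in at most one point). Laws (for every 4-element $R\subseteq P$ and all $D_1,D_2,D_3\in\Theta_P$, with $\phi_i=\phi(\pi_2(D_i),R\setminus\pi_1(D_i))$): (L1) if $\pi_1(D_1)\cup\pi_1(D_2)\cup\pi_1(D_3)=R$ and $|\pi_1(D_1)\cap\pi_1(D_2)\cap\pi_1(D_3)|=1$, then ($\phi_1=0\iff\phi_2=\phi_3$); (L2) under the same hypothesis, ($\phi_1=1\iff\phi_2\neq\phi_3$); (L3) if $D_1,D_2,D_3$ are pairwise distinct, $\pi_1(D_1)\cup\pi_1(D_2)\cup\pi_1(D_3)\subset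 R$ and this union has 3 elements, then ($\phi_1=\phi_2=0\Rightarrow\phi_3=1$). For $S\subseteq P$ with $|S|\geq4$, the sub div point set on $S$ is $\mathscr{X}|_S=(S,\{(d,\{X\cap S:X\in\delta\}):(d,\delta)\in\Theta_P,\ d\subseteq S\})$. Two div point sets $(A,\Theta_A),(B,\Theta_B)$ are isomorphic if there is a bijection $f:A\to B$ with $(f[d],\{f[X]:X\in\delta\})\in\Theta_B$ for every $(d,\delta)\in\Theta_A$. $Conc_4^1=(\{1,2,3,4\},\{(\{1,2\},\{\{3\},\{4\}\}),(\{1,3\},\{\{2\},\{4\}\}),(\{1,4\},\{\{2\},\{3\}\}),(\{2,3\},\{\{1,4\},\varnothing\}),(\{2,4\},\{\{1,3\},\varnothing\}),(\{3,4\},\{\{1,2\},\varnothing\})\})$. $Conv_4=(\{1,2,3,4\},\{(\{1,2\},\{\{3,4\},\varnothing\}),(\{1,3\},\{\{2\},\{4\}\}),(\{1,4\},\{\{2,3\},\varnothing\}),(\{2,3\},\{\{1,4\},\varnothing\}),(\{2,4\},\{\{1\},\{3\}\}),(\{3,4\},\{\{1,2\},\varnothing\})\})$. *)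

(* Defs.v *)
From mathcomp Require Import all_boot.

Set Implicit Arguments.
Unset Strict Implicit.
Unset Printing Implicit Defensive.

(* A pair (P, Theta) living in an ambient finite type T, before the axioms of
   a div point set are imposed.  An element D = (d, delta) of Theta has
   pi_1(D) = D.1 and pi_2(D) = D.2. *)
Definition division (T : finType) : Type := ({set T} * {set {set T}})%type.
Definition pre_dps (T : finType) : Type := ({set T} * {set division T})%type.

Definition is_dps (T : finType) (X : pre_dps T) : Prop :=
  [/\ X.1 != set0,
      #|X.2| = 'C(#|X.1|, 2),
      {in X.2, forall D : division T,
        [/\ D.1 \subset X.1, #|D.1| = 2, #|D.2| = 2,
            \bigcup_(A in D.2) A = X.1 :\: D.1 & \bigcap_(A in D.2) A = set0]}
    & {in X.2 &, forall D1 D2 : division T, D1 = D2 <-> D1.1 = D2.1}].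

Definition phi (T : finType) (delta : {set {set T}}) (S : {set T}) : nat :=
  if [exists A in delta, S \subset A] then 1 else 0.

Definition law1 (T : finType) (X : pre_dps T) : Prop :=
  forall R : {set T}, R \subset X.1 -> #|R| = 4 ->
  forall D1 D2 D3 : division T, D1 \in X.2 -> D2 \in X.2 -> D3 \in X.2 ->
  D1.1 :|: D2.1 :|: D3.1 = R -> #|D1.1 :&: D2.1 :&: D3.1| = 1 ->
  (phi D1.2 (R :\: D1.1) = 0
   <-> phi D2.2 (R :\: D2.1) = phi D3.2 (R :\: D3.1)).

Definition law2 (T : finType) (X : pre_dps T) : Prop :=
  forall R : {set T}, R \subset X.1 -> #|R| = 4 ->
  forall D1 D2 D3 : division T, D1 \in X.2 -> D2 \in X.2 -> D3 \in X.2 ->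
  D1.1 :|: D2.1 :|: D3.1 = R -> #|D1.1 :&: D2.1 :&: D3.1| = 1 ->
  (phi D1.2 (R :\: D1.1) = 1
   <-> phi D2.2 (R :\: D2.1) <> phi D3.2 (R :\: D3.1)).

Definition law3 (T : finType) (X : pre_dps T) : Prop :=
  forall R : {set T}, R \subset X.1 -> #|R| = 4 ->
  forall D1 D2 D3 : division T, D1 \in X.2 -> D2 \in X.2 -> D3 \in X.2 ->
  D1 <> D2 -> D1 <> D3 -> D2 <> D3 ->
  D1.1 :|: D2.1 :|: D3.1 \proper R -> #|D1.1 :|: D2.1 :|: D3.1| = 3 ->
  phi D1.2 (R :\: D1.1) = 0 -> phi D2.2 (R :\: D2.1) = 0 ->
  phi D3.2 (R :\: D3.1) = 1.

(* Only meaningful for S a subset of X.1 with at least 4 elements. *)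
Definition sub_dps (T : finType) (X : pre_dps T) (S : {set T}) : pre_dps T :=
  (S, [set (D.1, [set A :&: S | A in D.2])
        | D : division T in X.2 & D.1 \subset S]).

(* A bijection between the point sets is represented by a function between the
   ambient types; its values outside X.1 are irrelevant, and since the point
   sets are nonempty every bijection X.1 -> Y.1 extends to such a function. *)
Definition dps_iso (T U : finType) (X : pre_dps T) (Y : pre_dps U) : bool :=
  [exists f : {ffun T -> U},
    [&& dinjectiveb f X.1, f @: X.1 == Y.1
      & [forall D : division T, (D \in X.2) ==>
          ((f @: D.1, [set f @: A | A : {set T} in D.2]) \in Y.2)]]].

(* The labels 1, 2, 3, 4 are the nonzero elements of 'I_5. *)
Definition p1 : 'I_5 := @Ordinal 5 1 isT.
Definition p2 : 'I_5 := @Ordinal 5 2 isT.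
Definition p3 : 'I_5 := @Ordinal 5 3 isT.
Definition p4 : 'I_5 := @Ordinal 5 4 isT.

Definition Conc41 : pre_dps 'I_5 :=
  ([set p1; p2; p3; p4],
   [set ([set p1; p2], [set [set p3]; [set p4]]);
        ([set p1; p3], [set [set p2]; [set p4]]);
        ([set p1; p4], [set [set p2]; [set p3]]);
        ([set p2; p3], [set [set p1; p4]; set0]);
        ([set p2; p4], [set [set p1; p3]; set0]);
        ([set p3; p4], [set [set p1; p2]; set0])]).

Definition Conv4 : pre_dps 'I_5 :=
  ([set p1; p2; p3; p4],
   [set ([set p1; p2], [set [set p3; p4]; set0]);
        ([set p1; p3], [set [set p2]; [set p4]]);
        ([set p1; p4], [set [set p2; p3]; set0]);
        ([set p2; p3], [set [set p1; p4]; set0]);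
        ([set p2; p4], [set [set p1]; [set p3]]);
        ([set p3; p4], [set [set p1; p2]; set0])]).

(* Main.v *)
(* Call a division (d, delta) of X "split" by a quadruple R containing d when the
   two points of R \ d lie on different sides of delta (phi = 0).  In a fixed
   quadruple the split pairs form a graph on four vertices; (L1) makes all its
   degrees odd and (L3) makes it triangle free, so it is a star K_{1,3} (this is
   Conc_4^1, three edges) or a perfect matching (this is Conv_4, two edges).  On
   the other hand a fixed pair d is split by an even number of quadruples: a
   partition of the three points of P \ d into two sides separates 0 or 2 of
   their pairs.  Counting the incidences (R, d) both ways, 2 * 5 + n is even,
   where n <= 5 is the number of stars. *)

Require Import Defs.
From mathcomp Require Import all_boot.

Set Implicit Arguments.
Unset Strict Implicit.
Unset Printing Implicit Defensive.

(** * Pairs and quadruples in a finite set *)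

Section FiniteSets.
Variable T : finType.
Implicit Types (a b c d x y z : T) (A R : {set T}).

Lemma cards3E A : #|A| = 3 ->
  exists x y z, uniq [:: x; y; z] /\ A = [set x; y; z].
Proof.
have := enum_uniq A; have := mem_enum A; rewrite cardE.
case: (enum A) => [|x [|y [|z [|? ?]]]] // eA uA _; exists x, y, z; split=> //.
by apply/setP=> t; rewrite -eA !inE orbA.
Qed.

Lemma cards4E A : #|A| = 4 ->
  exists a b c d, uniq [:: a; b; c; d] /\ A = [set a; b; c; d].
Proof.
have := enum_uniq A; have := mem_enum A; rewrite cardE.
case: (enum A) => [|a [|b [|c [|d [|? ?]]]]] // eA uA _.
by exists a, b, c, d; split=> //; apply/setP=> t; rewrite -eA !inE !orbA.
Qed.

Lemma pairs4P a b c d A : A \subset [set a; b; c; d] -> #|A| = 2 ->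
  A \in [:: [set a; b]; [set a; c]; [set a; d];
            [set b; c]; [set b; d]; [set c; d]].
Proof.
move=> sA /eqP/cards2P[x [y [nxy eA]]]; subst A.
move: sA nxy; rewrite subUset !sub1set !inE -!orbA => /andP[].
move=> /or4P[]/eqP-> /or4P[]/eqP->; rewrite ?eqxx ?orbT // => _;
  by rewrite setUC eqxx ?orbT.
Qed.

Lemma quad_setD2 a b c d : uniq [:: a; b; c; d] ->
  [/\ [set a; b; c; d] :\: [set a; b] = [set c; d],
      [set a; b; c; d] :\: [set a; c] = [set b; d],
      [set a; b; c; d] :\: [set a; d] = [set b; c]
    & [/\ [set a; b; c; d] :\: [set b; c] = [set a; d],
      [set a; b; c; d] :\: [set b; d] = [set a; c]
    & [set a; b; c; d] :\: [set c; d] = [set a; b]]].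
Proof.
rewrite /= !inE !negb_or -!andbA => /and4P[nab nac nad /and3P[nbc nbd /andP[ncd _]]].
by do !split; apply/setP=> x; rewrite !inE;
  case: (x =P a) => [->|_]; rewrite ?(negPf nab) ?(negPf nac) ?(negPf nad) //;
  case: (x =P b) => [->|_]; rewrite ?(negPf nbc) ?(negPf nbd) //;
  case: (x =P c) => [->|_]; rewrite ?(negPf ncd) //; case: (x == d).
Qed.

Lemma card_quad a b c d : uniq [:: a; b; c; d] -> #|[set a; b; c; d]| = 4.
Proof.
move=> uR; rewrite (_ : [set a; b; c; d] = [set x in [:: a; b; c; d]]).
  by rewrite cardsE (card_uniqP uR).
by apply/setP=> x; rewrite !inE -!orbA.
Qed.

Lemma set2_neq a b c : uniq [:: a; b; c] -> [set a; b] != [set a; c].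
Proof.
rewrite /= !inE negb_or -!andbA => /and4P[nab _ nbc _].
apply: contraNneq nbc => /setP/(_ b).
by rewrite !inE eqxx orbT eq_sym (negPf nab) /= => <-.
Qed.

(** This lets the five quadruples of a five-point set be indexed by the point they omit. *)
Lemma subsets_card_pred A n : #|A| = n.+1 ->
  [set R : {set T} | (R \subset A) && (#|R| == n)] = [set A :\ z | z in A].
Proof.
move=> cA; apply/setP=> R; rewrite inE; apply/idP/imsetP=> [|[z zA ->]]; last first.
  by rewrite subD1set /= -eqSS -cA (cardsD1 z A) zA.
case/andP=> sRA /eqP cR.
have /eqP/cards1P[z eD] : #|A :\: R| = 1.
  by rewrite cardsD (setIidPr sRA) cA cR subSnn.
exists z; first by have := set11 z; rewrite -eD inE => /andP[].
by rewrite -eD setDDr setDv set0U (setIidPr sRA).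
Qed.

End FiniteSets.

(* Both ways a division can restrict to the remaining two points [u], [v] of a
   quadruple. *)
Definition part (U : finType) (s : bool) (u v : U) : {set {set U}} :=
  if s then [set [set u]; [set v]] else [set [set u; v]; set0].

Lemma imset_part (U V : finType) (f : U -> V) s u v :
  [set f @: A | A : {set U} in part s u v] = part s (f u) (f v).
Proof.
by case: s; rewrite /part imsetU1 imset_set1 /= ?imset0 ?imsetU1 !imset_set1.
Qed.

(** * Restricting divisions to a quadruple *)

Section DivPointSets.
Variables (T : finType) (X : pre_dps T).
Hypothesis hX : is_dps X.
Implicit Types (a b c d x y z : T) (A R e : {set T}) (D : division T).

(** The quantifier over [D] makes this a boolean depending on the pair alone; by [splitsE] it can be
    evaluated at any division with first component [e]. *)
Definition splits R e : bool :=
  [exists D in X.2, (D.1 == e) && (phi D.2 (R :\: e) == 0)].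

Lemma splitsE R D : D \in X.2 -> splits R D.1 = (phi D.2 (R :\: D.1) == 0).
Proof.
case: hX => _ _ _ inj DX; apply/exists_inP/idP=> [[D' D'X /andP[/eqP e]]|h].
  by have [_ /(_ e) <-] := inj _ _ D'X DX.
by exists D; rewrite ?eqxx.
Qed.

(** The first projection is injective on [X.2] and lands among the pairs of [X.1]; both sets have
    ['C(#|X.1|, 2)] elements, so every pair is reached. *)
Lemma division_ex e : e \subset X.1 -> #|e| = 2 -> exists2 D, D \in X.2 & D.1 = e.
Proof.
case: hX => _ cX dX inj se ce.
have sub : [set D.1 | D in X.2] \subset
    [set B : {set T} | B \subset X.1 & #|B| == 2].
  by apply/subsetP=> _ /imsetP[D /dX[sD cD _ _ _] ->]; rewrite inE sD cD eqxx.
have /eqP eq : [set D.1 | D in X.2] == [set B : {set T} | B \subset X.1 & #|B| == 2].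
  rewrite eqEcard sub cards_draws card_in_imset ?cX ?leqnn //.
  by move=> D1 D2 h1 h2; case: (inj _ _ h1 h2).
have : e \in [set D.1 | D in X.2] by rewrite eq inE se ce eqxx.
by case/imsetP=> D DX ->; exists D.
Qed.

Lemma division_sides D : D \in X.2 ->
  exists A B, [/\ D.2 = [set A; B], A :|: B = X.1 :\: D.1 & A :&: B = set0].
Proof.
case: hX => _ _ dX _ /dX[_ _ /eqP/cards2P[A [B [nAB ->]]]].
by rewrite !big_setU1 ?inE //= !big_set1 => eU eI; exists A, B.
Qed.

(** The sides partition the complement of [D.1], so [u] and [v] share a side exactly when [A]
    contains both or neither. The exclusive or turns later parity questions into boolean case
    checks. *)
Lemma split_sides R D A B u v : D \in X.2 -> R \subset X.1 ->
  R :\: D.1 = [set u; v] -> D.2 = [set A; B] ->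
  A :|: B = X.1 :\: D.1 -> A :&: B = set0 ->
  [/\ splits R D.1 = (u \in A) (+) (v \in A), (u \in B) = (u \notin A)
    & (v \in B) = (v \notin A)].
Proof.
move=> DX sR eR eD eU eI.
have inB w : w \in R :\: D.1 -> (w \in B) = (w \notin A).
  rewrite inE => /andP[wD wR]; have /setP/(_ w) := eU; have /setP/(_ w) := eI.
  by rewrite !inE wD (subsetP sR) //=; case: (w \in A) => //= ->.
have uB := inB u; have vB := inB v; rewrite eR !inE !eqxx orbT in uB vB.
have {uB vB}[uB vB] := (uB isT, vB isT); split=> //.
rewrite splitsE // /phi eR eD.
have -> : [exists C in [set A; B], [set u; v] \subset C] =
          ([set u; v] \subset A) || ([set u; v] \subset B).
  apply/exists_inP/orP=> [[C]|[]h]; last by exists B; rewrite ?inE ?eqxx ?orbT.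
    by rewrite !inE => /orP[]/eqP->; [left|right].
  by exists A; rewrite ?inE ?eqxx.
by rewrite !subUset !sub1set uB vB; case: (u \in A); case: (v \in A).
Qed.

(** Both sides avoid [D.1], so inside [R] they can meet only [u] and [v]: the traces are two
    singletons if the pair is split, and otherwise the whole of [[set u; v]] and the empty set. *)
Lemma restr_division R D u v : D \in X.2 -> R \subset X.1 ->
  R :\: D.1 = [set u; v] ->
  [set A :&: R | A in D.2] = part (splits R D.1) u v.
Proof.
move=> DX sR eR; have [A [B [eD eU eI]]] := division_sides DX.
have [-> uB vB] := split_sides DX sR eR eD eU eI.
have restr (C : {set T}) : C \subset A :|: B -> C :&: R = C :&: [set u; v].
  rewrite eU -eR => /subsetP sC; apply/setP=> x; rewrite !inE.
  by case xC: (x \in C) => //=; have := sC _ xC; rewrite inE => /andP[->].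
have pairI (C : {set T}) : C :&: [set u; v] =
    (if u \in C then [set u] else set0) :|: (if v \in C then [set v] else set0).
  rewrite setIUr; congr (_ :|: _); apply/setP=> x;
    by case: ifP => wC; rewrite !inE; case: (x =P _) => [->|]; rewrite ?wC ?andbF.
rewrite eD imsetU1 imset_set1 !restr ?subsetUl ?subsetUr // !pairI uB vB.
by rewrite /part; case: (u \in A); case: (v \in A); rewrite ?setU0 ?set0U // setUC.
Qed.

Lemma mem_sub_dps R e u v : R \subset X.1 -> e \subset R -> #|e| = 2 ->
  R :\: e = [set u; v] -> (e, part (splits R e) u v) \in (sub_dps X R).2.
Proof.
move=> sR se ce eR; have [D DX eD] := division_ex (subset_trans se sR) ce.
subst e; apply/imsetP; exists D; first by rewrite inE DX.
by rewrite (restr_division DX sR eR).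
Qed.

Lemma sub_dpsP R D : R \subset X.1 -> D \in (sub_dps X R).2 ->
  [/\ D.1 \subset R, #|D.1| = 2
    & forall u v, R :\: D.1 = [set u; v] -> D.2 = part (splits R D.1) u v].
Proof.
move=> sR /imsetP[D' ]; rewrite inE => /andP[D'X sD'] ->; split=> //=.
  by case: hX => _ _ /(_ _ D'X)[].
by move=> u v eR; rewrite (restr_division D'X sR eR).
Qed.

(** The six membership hypotheses are the images of the six restricted divisions under [a], [b],
    [c], [d] going to [p1], [p2], [p3], [p4]. This serves both target configurations. *)
Lemma quad_iso (Y : pre_dps 'I_5) a b c d (R := [set a; b; c; d])
    (s := fun x y => splits R [set x; y]) :
  uniq [:: a; b; c; d] -> R \subset X.1 -> Y.1 = [set p1; p2; p3; p4] ->
  ([set p1; p2], part (s a b) p3 p4) \in Y.2 ->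
  ([set p1; p3], part (s a c) p2 p4) \in Y.2 ->
  ([set p1; p4], part (s a d) p2 p3) \in Y.2 ->
  ([set p2; p3], part (s b c) p1 p4) \in Y.2 ->
  ([set p2; p4], part (s b d) p1 p3) \in Y.2 ->
  ([set p3; p4], part (s c d) p1 p2) \in Y.2 ->
  dps_iso (sub_dps X R) Y.
Proof.
move=> uR sR eY hab hac had hbc hbd hcd.
have [dab dac dad [dbc dbd dcd]] := quad_setD2 uR.
(* The last branch serves [d]; its value outside [R] is irrelevant. *)
pose f := [ffun x => if x == a then p1 else if x == b then p2
                     else if x == c then p3 else p4].
have [fa fb fc fd] : [/\ f a = p1, f b = p2, f c = p3 & f d = p4].
  move: uR; rewrite /= !inE !negb_or -!andbA => /and4P[nab nac nad].
  move=> /and3P[nbc nbd /andP[ncd _]]; rewrite !ffunE !eqxx.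
  by rewrite !ifN // eq_sym.
rewrite /dps_iso; apply/existsP; exists f; apply/and3P; split.
- apply/dinjectiveP => x y; rewrite !inE -!orbA.
  by move=> /or4P[]/eqP-> /or4P[]/eqP->; rewrite ?fa ?fb ?fc ?fd.
- by rewrite eY !imsetU !imset_set1 fa fb fc fd.
apply/forallP=> D; apply/implyP=> /(sub_dpsP sR)[sD cD eD].
move: (pairs4P sD cD); rewrite !inE.
case: D sD cD eD => e D2 /= _ _ eD.
by move=> /or4P[|||/or3P[]] /eqP ee; subst e;
  rewrite (eD _ _ dab) || rewrite (eD _ _ dac) || rewrite (eD _ _ dad)
  || rewrite (eD _ _ dbc) || rewrite (eD _ _ dbd) || rewrite (eD _ _ dcd);
  rewrite imset_part imsetU1 imset_set1 ?fa ?fb ?fc ?fd.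
Qed.

(** * The two shapes of a quadruple and their isomorphism types *)

Definition star R a b c d : bool :=
  [&& splits R [set a; b], splits R [set a; c], splits R [set a; d],
      ~~ splits R [set b; c], ~~ splits R [set b; d] & ~~ splits R [set c; d]].

(** The matched pairs are the first with the third and the second with the fourth point, following
    the labelling of [Conv4]. *)
Definition matching R a b c d : bool :=
  [&& ~~ splits R [set a; b], splits R [set a; c], ~~ splits R [set a; d],
      ~~ splits R [set b; c], splits R [set b; d] & ~~ splits R [set c; d]].

Lemma star_Conc41 a b c d (R := [set a; b; c; d]) :
  uniq [:: a; b; c; d] -> R \subset X.1 -> star R a b c d ->
  dps_iso (sub_dps X R) Conc41.
Proof.
move=> uR sR /and4P[sab sac sad /and3P[/negPf sbc /negPf sbd /negPf scd]].
by apply: quad_iso; rewrite // -/R ?(sab, sac, sad, sbc, sbd, scd) !inE eqxx ?orbT.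
Qed.

Lemma matching_Conv4 a b c d (R := [set a; b; c; d]) :
  uniq [:: a; b; c; d] -> R \subset X.1 -> matching R a b c d ->
  dps_iso (sub_dps X R) Conv4.
Proof.
move=> uR sR /and4P[/negPf sab sac /negPf sad /and3P[/negPf sbc sbd /negPf scd]].
by apply: quad_iso; rewrite // -/R ?(sab, sac, sad, sbc, sbd, scd) !inE eqxx ?orbT.
Qed.

(** An empty side marks a non-split pair, and the non-split pairs of [Conc41] form the triangle on
    [p2], [p3], [p4]. *)
Lemma Conc41_set0 (D : division 'I_5) : D \in Conc41.2 -> set0 \in D.2 -> p1 \notin D.1.
Proof.
have nz (p : 'I_5) : (set0 == [set p]) = false.
  by rewrite eq_sym; apply/negbTE/set0Pn; exists p; rewrite inE.
by rewrite !inE -!orbA => /or4P[|||/or3P[]] /eqP->; rewrite !inE ?nz.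
Qed.

(* An isomorphism onto [Conc41] would map some point to [p1]; that point lies on
   a non-split edge of the 4-cycle complementary to the matching, whereas all
   pairs through [p1] are split in [Conc41]. *)
Lemma matching_Conc41 a b c d (R := [set a; b; c; d]) :
  uniq [:: a; b; c; d] -> R \subset X.1 -> matching R a b c d ->
  ~~ dps_iso (sub_dps X R) Conc41.
Proof.
move=> uR sR /and4P[/negPf sab _ _ /and3P[_ _ /negPf scd]].
have [dab _ _ [_ _ dcd]] := quad_setD2 uR.
have [cab ccd] : #|[set a; b]| = 2 /\ #|[set c; d]| = 2.
  move: uR; rewrite /= !inE !negb_or -!andbA !cards2.
  by move=> /and5P[-> _ _ _ /and3P[_ -> _]].
rewrite /dps_iso; apply/existsP=> -[f /and3P[_ /eqP fR /forallP hf]].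
have out e u v : e \subset R -> #|e| = 2 -> R :\: e = [set u; v] ->
    splits R e = false -> p1 \notin f @: e.
  move=> se ce eR ns; have := mem_sub_dps sR se ce eR.
  move=> /(implyP (hf _)) /=; rewrite ns imset_part => /Conc41_set0; apply.
  by rewrite !inE eqxx orbT.
have : p1 \in f @: R by rewrite fR !inE eqxx.
have -> : R = [set a; b] :|: [set c; d] by rewrite setUA.
rewrite imsetU inE => /orP[]; apply/negP.
  by apply: out dab sab; rewrite // /R -setUA subsetUl.
by apply: out dcd scd; rewrite // /R -setUA subsetUr.
Qed.

(** * Number of split pairs in each shape *)

Definition split_pairs R : {set {set T}} :=
  [set e : {set T} | [&& e \subset R, #|e| == 2 & splits R e]].

Lemma card_star a b c d (R := [set a; b; c; d]) :
  uniq [:: a; b; c; d] -> star R a b c d -> #|split_pairs R| = 3.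
Proof.
move=> uR /and4P[sab sac sad /and3P[/negPf sbc /negPf sbd /negPf scd]].
have -> : split_pairs R = [set [set a; b]; [set a; c]; [set a; d]].
  apply/setP=> e; rewrite !inE -orbA; apply/and3P/or3P.
    move=> [se /eqP ce se']; move: (pairs4P se ce) se'; rewrite !inE.
    by move=> /or4P[|||/or3P[]] /eqP->; rewrite ?sbc ?sbd ?scd ?eqxx //;
      move=> _; [constructor 1 | constructor 2 | constructor 3].
  move: uR; rewrite /= !inE !negb_or -!andbA => /and4P[nab nac nad _].
  by case=> /eqP->; rewrite subUset !sub1set !inE !eqxx ?orbT cards2
    ?nab ?nac ?nad ?sab ?sac ?sad.
move: uR; rewrite /= !inE !negb_or -!andbA.
move=> /and4P[nab nac nad /and3P[nbc nbd /andP[ncd _]]].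
rewrite -setUA cardsU1 cards2 !inE !negb_or !set2_neq //= !inE negb_or;
  by rewrite ?nab ?nac ?nad ?nbc ?nbd ?ncd.
Qed.

Lemma card_matching a b c d (R := [set a; b; c; d]) :
  uniq [:: a; b; c; d] -> matching R a b c d -> #|split_pairs R| = 2.
Proof.
move=> uR /and4P[/negPf sab sac /negPf sad /and3P[/negPf sbc sbd /negPf scd]].
move: uR; rewrite /= !inE !negb_or -!andbA.
move=> /and4P[nab nac nad /and3P[nbc nbd /andP[ncd _]]].
have -> : split_pairs R = [set [set a; c]; [set b; d]].
  apply/setP=> e; rewrite !inE; apply/and3P/orP.
    move=> [se /eqP ce se']; move: (pairs4P se ce) se'; rewrite !inE.
    by move=> /or4P[|||/or3P[]] /eqP->; rewrite ?sab ?sad ?sbc ?scd ?eqxx //;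
      move=> _; [left | right].
  by case=> /eqP->; rewrite subUset !sub1set !inE !eqxx ?orbT cards2
    ?nac ?nbd ?sac ?sbd.
rewrite cards2; have -> //: [set a; c] != [set b; d].
apply/eqP=> /setP/(_ a).
by rewrite !inE eqxx (negPf nab) (negPf nad).
Qed.

(** * Consequences of the laws for one quadruple *)

Lemma division_pair x y : x \in X.1 -> y \in X.1 -> x != y ->
  exists2 D, D \in X.2 & D.1 = [set x; y].
Proof.
move=> xX yX nxy; apply: division_ex; last by rewrite cards2 nxy.
by rewrite subUset !sub1set xX yX.
Qed.

(** The three pairs through [a] cover [R] and meet only in [a], so (L1) applies. The equation says
    that an odd number of them is split. *)
Lemma law1_split R a b c d : law1 X -> uniq [:: a; b; c; d] ->
  R = [set a; b; c; d] -> R \subset X.1 ->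
  splits R [set a; b] = (splits R [set a; c] == splits R [set a; d]).
Proof.
move=> hL1 uR eR sR; have cR := card_quad uR; rewrite -eR in cR.
have [aX bX cX dX] : [/\ a \in X.1, b \in X.1, c \in X.1 & d \in X.1].
  by split; apply: (subsetP sR); rewrite eR !inE eqxx ?orbT.
move: uR; rewrite /= !inE !negb_or -!andbA.
move=> /and4P[nab nac nad /and3P[nbc nbd /andP[ncd _]]].
have [D1 h1 e1] := division_pair aX bX nab.
have [D2 h2 e2] := division_pair aX cX nac.
have [D3 h3 e3] := division_pair aX dX nad.
have := hL1 R sR cR D1 D2 D3 h1 h2 h3.
rewrite -e1 -e2 -e3 !splitsE // e1 e2 e3.
have -> : [set a; b] :|: [set a; c] :|: [set a; d] = R.
  by rewrite eR; apply/setP=> x; rewrite !inE; do !case: (_ == _).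
have -> : [set a; b] :&: [set a; c] :&: [set a; d] = [set a].
  apply/setP=> x; rewrite !inE; case: (x =P a) => //= _.
  by case: (x =P b) => //= ->; rewrite (negPf nbc).
rewrite cards1 => /(_ erefl erefl); rewrite /phi.
by case: ifP => _; case: ifP => _; case: ifP => _ [h h'] //;
  solve [by have := h erefl | by have := h' erefl].
Qed.

(** The edges of the triangle [a], [b], [c] are distinct, and their union misses [d], so (L3)
    forbids all three from being split. *)
Lemma law3_split R a b c d : law3 X -> uniq [:: a; b; c; d] ->
  R = [set a; b; c; d] -> R \subset X.1 ->
  ~~ [&& splits R [set a; b], splits R [set a; c] & splits R [set b; c]].
Proof.
move=> hL3 uR eR sR; have cR := card_quad uR; rewrite -eR in cR.
have [aX bX cX] : [/\ a \in X.1, b \in X.1 & c \in X.1].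
  by split; apply: (subsetP sR); rewrite eR !inE eqxx ?orbT.
move: uR; rewrite /= !inE !negb_or -!andbA.
move=> /and4P[nab nac nad /and3P[nbc nbd /andP[ncd _]]].
have [D1 h1 e1] := division_pair aX bX nab.
have [D2 h2 e2] := division_pair aX cX nac.
have [D3 h3 e3] := division_pair bX cX nbc.
have neq D D' x : x \in D.1 -> x \notin D'.1 -> D <> D'.
  by move=> xD xD' eD; rewrite eD (negPf xD') in xD.
have n12 : D1 <> D2.
  by apply: (neq _ _ b); rewrite ?e1 ?e2 !inE ?negb_or ?eqxx ?orbT // eq_sym nab.
have n13 : D1 <> D3 by apply: (neq _ _ a); rewrite ?e1 ?e3 !inE ?negb_or ?eqxx ?nab.
have n23 : D2 <> D3 by apply: (neq _ _ a); rewrite ?e2 ?e3 !inE ?negb_or ?eqxx ?nab.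
have eU : D1.1 :|: D2.1 :|: D3.1 = [set a; b; c].
  by rewrite e1 e2 e3; apply/setP=> x; rewrite !inE; do !case: (_ == _).
have c3 : #|[set a; b; c]| = 3.
  by rewrite -setUA cardsU1 cards2 !inE negb_or nab nac nbc.
have := hL3 R sR cR D1 D2 D3 h1 h2 h3 n12 n13 n23.
rewrite eU c3 properEcard c3 cR eR subsetUl -eR => /(_ isT erefl) h.
rewrite -e1 -e2 -e3 !splitsE //; apply/negP=> /and3P[/eqP f1 /eqP f2].
by rewrite h.
Qed.

Lemma quad_cases R : law1 X -> law3 X -> R \subset X.1 -> #|R| = 4 ->
  exists a b c d, [/\ uniq [:: a; b; c; d], R = [set a; b; c; d]
    & star R a b c d || matching R a b c d].
Proof.
move=> hL1 hL3 sR /cards4E[a [b [c [d [uR eR]]]]].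
pose lab a b c d := uniq [:: a; b; c; d] /\ R = [set a; b; c; d].
have sw1 x y z t : lab x y z t -> lab y x z t.
  case=> u e; split; last by rewrite e (setUC [set x]).
  by move: u; rewrite /= !inE (eq_sym y x); do !case: (_ == _).
have sw2 x y z t : lab x y z t -> lab x z y t.
  case=> u e; split; last by rewrite e [[set x; y; z]]setUAC.
  by move: u; rewrite /= !inE (eq_sym z y); do !case: (_ == _).
have sw3 x y z t : lab x y z t -> lab x y t z.
  case=> u e; split; last by rewrite e setUAC.
  by move: u; rewrite /= !inE (eq_sym t z); do !case: (_ == _).
have l0 : lab a b c d by [].
have lb := sw1 _ _ _ _ l0; have lc := sw1 _ _ _ _ (sw2 _ _ _ _ l0).
have ld := sw1 _ _ _ _ (sw2 _ _ _ _ (sw3 _ _ _ _ l0)).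
have l1 := sw2 _ _ _ _ l0; have l2 := sw3 _ _ _ _ l0.
have l3 := sw3 _ _ _ _ l1; have l4 := sw3 _ _ _ _ (sw2 _ _ _ _ lb).
have law1E x y z t (l : lab x y z t) := law1_split hL1 l.1 l.2 sR.
have law3E x y z t (l : lab x y z t) := law3_split hL3 l.1 l.2 sR.
(* The first four orders put each point in turn at the centre of a star; the first and the last two
   give the three perfect matchings. *)
have : [|| star R a b c d || matching R a b c d,
           star R b a c d || matching R b a c d,
           star R c a b d || matching R c a b d,
           star R d a b c || matching R d a b c,
           star R a c b d || matching R a c b d
         | star R a b d c || matching R a b d c].
  (* Degree parity at the four vertices and the four triangles; once the pairs are written in one
     order, six booleans remain to be enumerated. *)
  move: (law1E _ _ _ _ l0) (law1E _ _ _ _ lb) (law1E _ _ _ _ lc) (law1E _ _ _ _ ld).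
  move: (law3E _ _ _ _ l0) (law3E _ _ _ _ l2) (law3E _ _ _ _ l3) (law3E _ _ _ _ l4).
  rewrite /star /matching !(setUC [set b] [set a]) !(setUC [set c] [set a]).
  rewrite !(setUC [set d] [set a]) !(setUC [set c] [set b]).
  rewrite !(setUC [set d] [set b]) !(setUC [set d] [set c]).
  case: (splits R [set a; b]); case: (splits R [set a; c]);
  case: (splits R [set a; d]); case: (splits R [set b; c]);
  by case: (splits R [set b; d]); case: (splits R [set c; d]).
have ex x y z t : lab x y z t -> star R x y z t || matching R x y z t ->
    exists a b c d, [/\ uniq [:: a; b; c; d], R = [set a; b; c; d]
      & star R a b c d || matching R a b c d].
  by case=> u e h; exists x, y, z, t.
by case/or4P=> [||| /or3P[]]; apply: ex.
Qed.

(** * Parity of the incidences and the final count *)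

Lemma even_split e : #|X.1| = 5 -> e \subset X.1 -> #|e| = 2 ->
  2 %| \sum_(z in X.1) ((e \subset X.1 :\ z) && splits (X.1 :\ z) e).
Proof.
move=> c5 se ce; have [D DX eD] := division_ex se ce.
have [A [B [eD2 eU eI]]] := division_sides DX.
have /cards3E[x [y [z [uxyz exyz]]]] : #|X.1 :\: e| = 3.
  by rewrite cardsD (setIidPr se) c5 ce.
(* Omitting a point of [e] leaves no quadruple containing [e], so only the three points outside [e]
   contribute. *)
rewrite (big_setID e) /= big1 ?add0n => [|w]; last first.
  by rewrite inE => /andP[_ we]; rewrite subsetD1 we andbF.
move: uxyz; rewrite /= !inE negb_or -!andbA => /and4P[nxy nxz nyz _].
rewrite exyz -setUA !big_setU1 ?inE ?negb_or ?nxy ?nxz //= big_set1.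
have sub w : w \in X.1 :\: e -> e \subset X.1 :\ w.
  by rewrite inE subsetD1 se => /andP[].
rewrite !sub ?exyz ?inE ?eqxx ?orbT //=.
have val u v w : X.1 :\: e = [set u; v; w] -> u != w -> v != w ->
    splits (X.1 :\ w) e = (u \in A) (+) (v \in A).
  move=> euvw nuw nvw; subst e.
  have [] // := @split_sides (X.1 :\ w) D A B u v DX (subD1set _ _) _ eD2 eU eI.
  rewrite setDDl setUC -setDDl euvw; apply/setP=> t; rewrite !inE.
  by case: (t =P w) => [->|_]; rewrite ?orbF // !(eq_sym w) (negPf nuw) (negPf nvw).
have e1 : X.1 :\: e = [set y; z; x] by rewrite exyz -setUA setUC.
have e2 : X.1 :\: e = [set x; z; y] by rewrite exyz setUAC.
(* Each of the three membership bits occurs in two of the exclusive ors, so 0 or 2 of them are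
   true. *)
rewrite (val _ _ _ e1) ?(val _ _ _ e2) ?(val _ _ _ exyz) //; try by rewrite eq_sym.
by case: (x \in A); case: (y \in A); case: (z \in A).
Qed.

End DivPointSets.

Theorem theorem2 (T : finType) (X : pre_dps T)
  (hX : is_dps X) (hcard : #|X.1| = 5)
  (hL1 : law1 X) (hL2 : law2 X) (hL3 : law3 X) :
  let quads := [set R : {set T} | (R \subset X.1) && (#|R| == 4)] in
  let n := #|[set R in quads | dps_iso (sub_dps X R) Conc41]| in
  (n = 4 \/ n = 2 \/ n = 0) /\
  (forall R : {set T}, R \in quads ->
     ~~ dps_iso (sub_dps X R) Conc41 -> dps_iso (sub_dps X R) Conv4).
Proof.
move=> quads n.
(* The isomorphism test, read as 0 or 1, is the excess of split pairs over a matching. *)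
have quadP R : R \in quads ->
    #|split_pairs X R| = 2 + dps_iso (sub_dps X R) Conc41 /\
    (~~ dps_iso (sub_dps X R) Conc41 -> dps_iso (sub_dps X R) Conv4).
  rewrite inE => /andP[sR /eqP cR].
  have [a [b [c [d [uR eR /orP[]h]]]]] := quad_cases hX hL1 hL3 sR cR;
    rewrite eR in sR h *.
    by rewrite (star_Conc41 hX uR sR h) (card_star uR h).
  rewrite (negPf (matching_Conc41 hX uR sR h)) (card_matching uR h).
  by rewrite (matching_Conv4 hX uR sR h).
split=> [|R /quadP[]//].
have cq : #|quads| = 5 by rewrite cards_draws hcard.
have le_n : n <= 5.
  by rewrite -cq; apply/subset_leq_card/subsetP=> R; rewrite inE => /andP[].
have sum_n : \sum_(R in quads) #|split_pairs X R| = 10 + n.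
  rewrite (eq_bigr _ (fun R hR => (quadP R hR).1)) big_split /=.
  rewrite sum_nat_const cq; congr (_ + _).
  rewrite /n -sum1_card -big_mkcondr /=.
  by apply: eq_bigl => R; rewrite !inE.
have : 2 %| 10 + n.
  rewrite -sum_n.
  under eq_bigr => R do rewrite -sum1_card.
  pose pairs := [set e : {set T} | (e \subset X.1) && (#|e| == 2)].
  (* Moving the dependence on [R] into the summand makes the two ranges independent, so that the
     sums can be exchanged. *)
  have -> : \sum_(R in quads) \sum_(e in split_pairs X R) 1 =
      \sum_(R in quads) \sum_(e in pairs) ((e \subset R) && splits X R e).
    apply: eq_bigr => R; rewrite inE => /andP[sR _].
    rewrite -big_mkcondr /=; apply: eq_bigl => e; rewrite !inE.
    have [se|] := boolP (e \subset R); last by rewrite andbF.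
    by rewrite (subset_trans se sR).
  rewrite exchange_big /=; apply: dvdn_sum => e; rewrite inE => /andP[se /eqP ce].
  rewrite /quads (subsets_card_pred hcard) big_imset /=; first exact: even_split.
  (* Distinct omitted points give distinct quadruples. *)
  move=> x y xX yX /setP/(_ x); rewrite !inE eqxx xX /= andbT.
  by move/esym/negbT; rewrite negbK => /eqP.
by move: n le_n {sum_n} => [|[|[|[|[|[|n]]]]]] // _ _; [right; right | right; left | left].
Qed.
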